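(* Let $r_1,\dots,r_4\in\mathbb{C}$ and $s_1,\dots,s_6\in\mathbb{C}\setminus\{0\}$. Let $\mathbb{B}=\mathbb{B}(r_1,\dots,r_4;s_1,\dots,s_6)$, acting as a bounded linear operator on $c_0$. Then the point spectrum of $\mathbb{B}$ is empty: $\sigma_p(\mathbb{B},c_0)=\emptyset$.
   Context: $c_0$ is the Banach space of complex sequences $x=(x_k)_{k\ge 0}$ converging to $0$, with the supremum norm. For an integer $a$ and $n\in\mathbb{N}$, $a\,(\mathrm{mod}\ n)$ denotes the remainder in $\{0,\dots,n-1\}$ of $a$ modulo $n$. The matrix $\mathbb{B}(r_1,\dots,r_4;s_1,\dots,s_6)=(b_{ij})_{i,j\ge 0}$ is the infinite lower triangular matrix with $b_{ij}=r_{j(\mathrm{mod}\ 4)+1}$ if $i=j$, $b_{ij}=s_{j(\mathrm{mod}\ 6)+1}$ if $i=j+1$, and $b_{ij}=0$ otherwise; it acts on sequences by $(\mathbb{B}x)_k=\sum_{j}b_{kj}x_j$. The point spectrum $\sigma_p(T,X)$ is the set of $\lambda\in\mathbb{C}$ for which $(T-\lambda I)^{-1}$ does not exist, i.e. $T-\lambda I$ is not injective on $X$ (the eigenvalues of $T$). *)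

(* Defs.v *)
From HB Require Import structures.
From mathcomp Require Import all_boot all_order all_algebra.
From mathcomp Require Import complex.
From mathcomp Require Import all_classical all_reals all_analysis.

Set Implicit Arguments.
Unset Strict Implicit.
Unset Printing Implicit Defensive.

Import Order.TTheory GRing.Theory Num.Theory.
Import numFieldNormedType.Exports.

Local Open Scope classical_set_scope.
Local Open Scope ring_scope.
Local Open Scope complex_scope.

Section SpaceC0.
Variable K : numFieldType.

Definition c0_pred : {pred nat -> K} :=
  [pred x : nat -> K | `[< x @ \oo --> (0 : K) >]].

Lemma c0_predP (x : nat -> K) :
  reflect (x @ \oo --> (0 : K)) (x \in c0_pred).
Proof. by rewrite inE; exact: asboolP. Qed.

Fact c0_submod_closed : submod_closed c0_pred.
Proof.
split; first by apply/c0_predP; exact: (cvg_cst (0 : K)).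
move=> a x y /c0_predP xc /c0_predP yc; apply/c0_predP.
rewrite -[X in _ --> X](addr0 (0 : K)) -[X in _ --> X + _](mulr0 a).
by apply: cvgD => //; apply: cvgM => //; exact: cvg_cst.
Qed.

HB.instance Definition _ :=
  GRing.isSubmodClosed.Build K (nat -> K) c0_pred c0_submod_closed.

Record c0 := C0 { c0_seq :> nat -> K; c0_seqP : c0_seq \in c0_pred }.

HB.instance Definition _ := [isSub for c0_seq].
HB.instance Definition _ := [Choice of c0 by <:].
HB.instance Definition _ := [SubChoice_isSubLmodule of c0 by <:].

Lemma c0_cvg (x : c0) : x @ \oo --> (0 : K).
Proof. exact/c0_predP/c0_seqP. Qed.

Lemma c0_bounded (x : c0) : exists M : K, forall k, `|x k| <= M.
Proof.
have /cvg_seq_bounded : cvgn (x : nat -> K).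
  by apply/cvg_ex; exists 0; exact: c0_cvg.
have PF : ProperFilter (globally [set: nat]).
  exact: (@globally_properfilter _ _ 0%N).
by move=> /ex_bound[M HM]; exists M => k; exact: HM.
Qed.

End SpaceC0.

Section SupNorm.
Variable R : realType.
Implicit Types x y : c0 R[i].

(* In R[i], `|z| is the modulus of z seen as an element of R[i], whence the
   real part before the supremum and the embedding %:C after it. *)
Definition c0_norm x : R[i] :=
  (sup [set complex.Re `|x k| | k in [set: nat]])%:C.

Let ReK (z : R[i]) : (complex.Re `|z|)%:C = `|z|.
Proof. by rewrite normc_def. Qed.

Let le_ReR (M : R[i]) (z : R[i]) : `|z| <= M -> complex.Re `|z| <= complex.Re M.
Proof. by rewrite lecE => /andP[]. Qed.

Lemma le_c0_norm x k : `|x k| <= c0_norm x.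
Proof.
rewrite -ReK lecR; apply: ub_le_sup; last by exists k.
have [M HM] := c0_bounded x.
by exists (complex.Re M) => _ [j _ <-]; exact: le_ReR.
Qed.

Lemma c0_norm_le x (M : R[i]) : (forall k, `|x k| <= M) -> c0_norm x <= M.
Proof.
move=> HM.
have -> : M = (complex.Re M)%:C.
  have := le_trans (normr_ge0 _) (HM 0%N).
  by case: M {HM} => a b; rewrite lecE/= => /andP[/eqP->].
rewrite lecR; apply: ge_sup; first by exists (complex.Re `|x 0%N|), 0%N.
by move=> _ [j _ <-]; exact: le_ReR.
Qed.

Let c0_normD x y : c0_norm (x + y) <= c0_norm x + c0_norm y.
Proof.
apply: c0_norm_le => k; apply: le_trans (ler_normD (x k) (y k)) _.
by apply: lerD; exact: le_c0_norm.
Qed.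

Let c0_norm_ge0 x : 0 <= c0_norm x.
Proof. exact: le_trans (normr_ge0 _) (le_c0_norm x 0%N). Qed.

Let c0_normZle (l : R[i]) x : c0_norm (l *: x) <= `|l| * c0_norm x.
Proof.
apply: c0_norm_le => k.
have -> : (l *: x) k = l * x k by [].
by rewrite normrM ler_wpM2l// le_c0_norm.
Qed.

Let c0_normZ (l : R[i]) x : c0_norm (l *: x) = `|l| * c0_norm x.
Proof.
have [->|l0] := eqVneq l 0.
  rewrite normr0 mul0r; apply/eqP; rewrite eq_le c0_norm_ge0 andbT.
  by have := c0_normZle 0 x; rewrite normr0 mul0r.
apply/eqP; rewrite eq_le c0_normZle/=.
have := c0_normZle l^-1 (l *: x).
by rewrite scalerA mulVf// scale1r normfV ler_pdivlMl// normr_gt0.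
Qed.

Let c0_norm_eq0 x : c0_norm x = 0 -> x = 0.
Proof.
move=> x0; apply/val_inj/funext => k /=; apply/eqP.
by rewrite -normr_le0 -x0 le_c0_norm.
Qed.

HB.instance Definition _ :=
  Lmodule_isNormed.Build R[i] (c0 R[i]) c0_normD c0_normZ c0_norm_eq0.

Lemma c0_normE x : `|x| = c0_norm x. Proof. by []. Qed.

End SupNorm.

Section BoundedOperator.
Variables (K : numFieldType) (V : normedModType K).

Record boundedOp := BoundedOp {
  boundedOp_linear :> {linear V -> V};
  boundedOpP : bounded_near boundedOp_linear (nbhs (0 : V)) }.

Definition point_spectrum (T : boundedOp) : set K :=
  [set lambda | ~ injective (fun x : V => T x - lambda *: x)].

End BoundedOperator.

Section Matrix.
Variable K : numFieldType.

Definition imx_act (b : nat -> nat -> K) (x : nat -> K) : nat -> K :=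
  fun k => limn (series (fun j => b k j * x j)).

(* The indices of r and s start at 0: r_(m+1) of the text is r m. *)
Definition Bmx (r : 'I_4 -> K) (s : 'I_6 -> K) (i j : nat) : K :=
  if i == j then r (inord (j %% 4))
  else if i == j.+1 then s (inord (j %% 6))
  else 0.

Variables (r : 'I_4 -> K) (s : 'I_6 -> K).

Lemma imx_act_Bmx (x : nat -> K) k :
  imx_act (Bmx r s) x k =
    r (inord (k %% 4)) * x k +
    (if k is j.+1 then s (inord (j %% 6)) * x j else 0).
Proof.
apply: lim_near_cst; first exact: norm_hausdorff.
exists k.+1 => // n /= kn.
rewrite /series/= big_mkord (bigD1 (Ordinal kn))//= /Bmx eqxx; congr (_ + _).
case: k kn => [|k] kn.
  rewrite big1// => i /eqP ik; case: eqP => [i0|_]; last by rewrite mul0r.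
  by case: ik; exact/val_inj.
rewrite (bigD1 (Ordinal (ltnW kn)))/=; last first.
  by rewrite -val_eqE/= -[X in X == _]addn0 -addn1 eqn_add2l.
rewrite gtn_eqF// eqxx big1 ?addr0// => i /andP[ik ik'].
have -> : (k.+1 == i) = false by apply: contra_neqF ik => /eqP ik; exact/val_inj.
have -> : (k.+1 == i.+1) = false.
  by apply: contra_neqF ik' => /eqP[ik']; exact/val_inj.
by rewrite mul0r.
Qed.

Definition Bmx_bound : K := \sum_i `|r i| + \sum_i `|s i|.

Lemma le_imx_act_Bmx (x : nat -> K) k :
  `|imx_act (Bmx r s) x k| <=
    Bmx_bound * (`|x k| + (if k is j.+1 then `|x j| else 0)).
Proof.
have rle (i : 'I_4) : `|r i| <= Bmx_bound.
  rewrite /Bmx_bound (bigD1 i)//= -addrA lerDl addr_ge0// sumr_ge0//.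
have sle (i : 'I_6) : `|s i| <= Bmx_bound.
  by rewrite /Bmx_bound (bigD1 i)//= addrCA lerDl addr_ge0// sumr_ge0.
rewrite imx_act_Bmx mulrDr (le_trans (ler_normD _ _))// lerD//.
  by rewrite normrM ler_wpM2r.
by case: k => [|k]; rewrite ?normr0 ?mulr0// normrM ler_wpM2r.
Qed.

Lemma imx_act_Bmx_c0 (x : c0 K) : imx_act (Bmx r s) x \in @c0_pred K.
Proof.
have xc := c0_cvg x; apply/c0_predP.
have M0 : 0 < Bmx_bound + 1.
  by rewrite ltr_wpDl// addr_ge0// sumr_ge0.
apply/cvgr0Pnorm_lt => e e0.
have e'0 : 0 < e / 2 / (Bmx_bound + 1) by rewrite !divr_gt0.
have /cvgr0Pnorm_lt/(_ _ e'0)[N _ HN] := xc.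
exists N.+1 => // -[//|k] /= Nk.
apply: le_lt_trans (le_imx_act_Bmx x k.+1) _.
have h1 := HN k.+1 (leqW Nk); have h2 := HN k Nk.
rewrite [ltRHS]splitr -(divfK (lt0r_neq0 M0) (e / 2)) -mulrDl mulrC.
apply: le_lt_trans (_ : _ <= (`|x k.+1| + `|x k|) * (Bmx_bound + 1)) _.
  by rewrite ler_wpM2l ?addr_ge0// lerDl.
by rewrite ltr_pM2r// ltrD.
Qed.

Definition Bact (x : c0 K) : c0 K := C0 (imx_act_Bmx_c0 x).

Fact Bact_linear : linear Bact.
Proof.
move=> a x y; apply/val_inj/funext => k /=.
rewrite -[RHS]/(a * imx_act (Bmx r s) x k + imx_act (Bmx r s) y k).
rewrite !imx_act_Bmx.
have E j : (a *: c0_seq x + c0_seq y) j = a * x j + y j by [].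
by case: k => [|k]; rewrite !E; [rewrite !addr0|]; rewrite !mulrDr;
   rewrite ?[a * (_ * _)]mulrCA// addrACA.
Qed.

HB.instance Definition _ :=
  GRing.isLinear.Build K (c0 K) (c0 K) _ Bact Bact_linear.

End Matrix.

Section BOperator.
Variables (R : realType) (r : 'I_4 -> R[i]) (s : 'I_6 -> R[i]).

Fact Bact_bounded : bounded_near (Bact r s) (nbhs (0 : c0 R[i])).
Proof.
apply/(bounded_funP (Bact r s)) => e.
exists (Bmx_bound r s * (e + e)) => x xe.
rewrite c0_normE; apply: c0_norm_le => k.
have xk j : `|x j| <= e by apply: le_trans (le_c0_norm x j) _; rewrite -c0_normE.
have e0 : 0 <= e := le_trans (normr_ge0 _) xe.
apply: le_trans (le_imx_act_Bmx r s x k) _.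
rewrite ler_wpM2l ?addr_ge0 ?sumr_ge0// lerD//.
by case: k.
Qed.

Definition Bop : boundedOp (c0 R[i]) := BoundedOp Bact_bounded.

End BOperator.

(* Main.v *)
Require Import Defs.
From mathcomp Require Import all_boot all_order all_algebra.
From mathcomp Require Import complex.
From mathcomp Require Import all_classical all_reals all_analysis.

Local Open Scope classical_set_scope.
Local Open Scope ring_scope.

Import GRing.Theory.

(** The eigenvalue equation reads [(r_0 - lambda) x_0 = 0] and
    [(r_(k+1) - lambda) x_(k+1) + s_k x_k = 0].  If [lambda] is none of the
    [r_i], then [x_0 = 0] and the recurrence propagates zeros upwards.  If
    [lambda = r_i], the recurrence forces [x_k = 0] whenever [k + 1] is congruent
    to [i] modulo 4, and since the [s_k] do not vanish it propagates zeros
    downwards from these arbitrarily large indices. *)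

Section TwoTermRecurrence.
Context {K : idomainType} {a b x : nat -> K}.
Hypothesis rec : forall k, a k.+1 * x k.+1 + b k * x k = 0.

Lemma recurrence_eq0_up : (forall k, a k != 0) -> a 0 * x 0 = 0 ->
  forall k, x k = 0.
Proof.
move=> a0 ax0; elim=> [|k IHk]; apply/eqP.
  by move/eqP: ax0; rewrite mulf_eq0 (negPf (a0 0)).
by move/eqP: (rec k); rewrite IHk mulr0 addr0 mulf_eq0 (negPf (a0 _)).
Qed.

Lemma recurrence_eq0_down : (forall k, b k != 0) ->
  (forall n, exists2 k, (n <= k)%N & a k.+1 = 0) -> forall k, x k = 0.
Proof.
move=> b0 aio n.
have down k : a k.+1 * x k.+1 = 0 -> x k = 0.
  move=> akx; apply/eqP; move/eqP: (rec k).
  by rewrite akx add0r mulf_eq0 (negPf (b0 k)).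
(* Writing [n] as [k - (k - n)] turns the descent from [k] into an induction on the distance below
   [k]; the bound by [k] is carried along because subtraction truncates at 0. *)
have [k nk ak0] := aio n; rewrite -(subKn nk).
elim: (k - n)%N (leq_subr n k) => [_|i IHi ik].
  by rewrite subn0 down// ak0 mul0r.
by apply: down; rewrite subnSK// IHi ?mulr0// ltnW.
Qed.

End TwoTermRecurrence.

Theorem theorem4p3 (R : realType) (r : 'I_4 -> R[i]) (s : 'I_6 -> R[i])
  (hs : forall m : 'I_6, s m != 0) :
  point_spectrum (Bop r s) = set0.
Proof.
rewrite -subset0 => l; apply => x y Exy.
have {}Exy : Bact r s x - l *: x = Bact r s y - l *: y := Exy.
pose z : c0 R[i] := x - y.
have Bz : Bact r s z = l *: z.
  move/eqP: Exy; rewrite linearB/= scalerBr subr_eq => /eqP ->.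
  by rewrite addrC !addrA addNr add0r addrC.
have rowE k : r (inord (k %% 4)) * z k +
    (if k is j.+1 then s (inord (j %% 6)) * z j else 0) = l * z k.
  by rewrite -imx_act_Bmx -[RHS]/((l *: z) k) -Bz.
pose a k := r (inord (k %% 4)) - l.
pose b k := s (inord (k %% 6)).
have rec k : a k.+1 * z k.+1 + b k * z k = 0.
  by rewrite mulrBl addrAC rowE subrr.
suff z0 k : z k = 0.
  by apply/eqP; rewrite -subr_eq0; apply/eqP/val_inj/funext => k; exact: z0.
have [/existsP[i /eqP ri]|/existsPn rl] := boolP [exists i, r i == l].
  apply: (recurrence_eq0_down rec) => [j|n]; first exact: hs.
  (* The offset 3 makes the successor [n.+1 * 4 + i], of residue [i] modulo 4, where [a]
     vanishes. *)
  exists (n * 4 + i + 3)%N; first by rewrite -addnA (leq_trans _ (leq_addr _ _))// leq_pmulr.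
  have -> : ((n * 4 + i + 3).+1 = n.+1 * 4 + i)%N.
    by rewrite -addnS mulSn addnC addnA.
  by rewrite /a modnMDl modn_small// inord_val ri subrr.
apply: (recurrence_eq0_up rec) => [j|]; first by rewrite subr_eq0 rl.
(* Row 0 has no subdiagonal entry. *)
by rewrite mulrBl -(rowE 0) addr0 subrr.
Qed.
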